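(* For all $j\in\mathbb{Z}$ and $k\ge -1$, $$F_{j,k}=\sum_{I\in J(P_k)}\ \prod_{(r,s,t)\in I}y_{3r+s+j}.$$
   Context: Let $y_j$ ($j\in\mathbb{Z}$) be indeterminates with $y_{j+2n}=y_j$ for a fixed $n\ge1$. $F_{j,k}\in\mathbb{Q}(y_1,\dots,y_{2n})$ is defined by $F_{j,-1}=F_{j,0}=1$ for all $j$ and, for $k\ge0$, $F_{j,k+1}=\dfrac{F_{j-3,k}F_{j+3,k}+\left(\prod_{i=-k}^{k}y_{j+3i}\right)F_{j-1,k}F_{j+1,k}}{F_{j,k-1}}$. For an integer $k$, $Q_k$ is the set of $(r,s,t)\in\mathbb{Z}^3$ with $2|s|-(k-2)\le t\le k-2-2|r|$ and $2|s|-(k-2)\equiv t\equiv k-2-2|r|\pmod 4$; $P_k=Q_{k+1}\cup Q_k$, with the partial order generated by: $(r',s',t')$ covers $(r,s,t)$ iff $t'=t+1$ and $|r'-r|+|s'-s|=1$. $J(P_k)$ is the set of order ideals (down-closed subsets, including $\emptyset$) of $P_k$. *)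

(* Defs.v *)
From HB Require Import structures.
From mathcomp Require Import all_boot all_order all_algebra fraction finmap.
From mathcomp Require Import mpoly zify.

Set Implicit Arguments.
Unset Strict Implicit.
Unset Printing Implicit Defensive.

Import Order.TTheory GRing.Theory Num.Theory.
Local Open Scope ring_scope.

Lemma yidx_subproof (n : nat) (hn : (0 < n)%N) (j : int) :
  (`|(j %% (2 * n)%N%:Z)%Z| < 2 * n)%N.
Proof. lia. Qed.

Definition yidx (n : nat) (hn : (0 < n)%N) (j : int) : 'I_(2 * n) :=
  Ordinal (yidx_subproof hn j).

(* Residues mod 2n are represented by 0, ..., 2n-1, so y_{2n} is 'X_0. *)
Definition y (n : nat) (hn : (0 < n)%N) (j : int) :
    {fraction {mpoly rat[2 * n]}} :=
  tofrac 'X_(yidx hn j).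

(* Fshift m j is F_{j,m-1}, so that the recursion is on a natural number. *)
Fixpoint Fshift (n : nat) (hn : (0 < n)%N) (m : nat) {struct m} :
    int -> {fraction {mpoly rat[2 * n]}} :=
  match m with
  | 0 => fun=> 1
  | m'.+1 =>
    match m' with
    | 0 => fun=> 1
    | k.+1 => fun j =>
      (Fshift hn m' (j - 3) * Fshift hn m' (j + 3)
       + (\prod_(0 <= i < (2 * k).+1) y hn (j + 3 * (i%:Z - k%:Z)))
         * Fshift hn m' (j - 1) * Fshift hn m' (j + 1))
      / Fshift hn k j
    end
  end.

(* Meaningful for k >= -1; the value 1 for k < -1 is junk. *)
Definition F (n : nat) (hn : (0 < n)%N) (j k : int) :
    {fraction {mpoly rat[2 * n]}} :=
  if k is Posz m then Fshift hn m.+1 j else 1.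

Lemma F_m1 (n : nat) (hn : (0 < n)%N) (j : int) : F hn j (-1) = 1.
Proof. by []. Qed.

Lemma F_0 (n : nat) (hn : (0 < n)%N) (j : int) : F hn j 0 = 1.
Proof. by []. Qed.

Lemma F_rec (n : nat) (hn : (0 < n)%N) (j : int) (k : nat) :
  F hn j (k%:Z + 1) =
  (F hn (j - 3) k * F hn (j + 3) k
   + (\prod_(0 <= i < (2 * k).+1) y hn (j + 3 * (i%:Z - k%:Z)))
     * F hn (j - 1) k * F hn (j + 1) k)
  / F hn j (k%:Z - 1).
Proof.
rewrite -PoszD addn1; case: k => [|k] //.
by have -> : k.+1%:Z - 1 = k by lia.
Qed.

Definition Qcond (k : int) (x : int * int * int) : bool :=
  let: (r, s, t) := x in
  [&& 2 * `|s| - (k - 2) <= t, t <= k - 2 - 2 * `|r|,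
      (2 * `|s| - (k - 2) == t %[mod 4])%Z
    & (t == k - 2 - 2 * `|r| %[mod 4])%Z].

(* Q_k is carved out of the cube [-|k|, |k|]^3, which loses no point (in_Q). *)
Definition irange (N : nat) : seq int :=
  [seq i%:Z - N%:Z | i <- iota 0 (2 * N + 1)].

Definition cube (N : nat) : seq (int * int * int) :=
  [seq (rs, t) | rs <- [seq (r, s) | r <- irange N, s <- irange N],
                 t <- irange N].

Definition Q (k : int) : {fset int * int * int} :=
  [fset x in cube `|k|%N | Qcond k x]%fset.

Lemma mem_irange (N : nat) (i : int) : (i \in irange N) = (`|i| <= N%:Z).
Proof.
apply/mapP/idP => [[m]|hi]; first by rewrite mem_iota => hm ->; lia.
by exists (absz (i + N%:Z)); [rewrite mem_iota; lia | lia].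
Qed.

Lemma mem_cube (N : nat) (r s t : int) :
  ((r, s, t) \in cube N) = [&& `|r| <= N%:Z, `|s| <= N%:Z & `|t| <= N%:Z].
Proof.
rewrite -!mem_irange andbA; apply/allpairsP/andP => [[[[r' s'] t'] /= []]|[]].
  by case/allpairsP => -[r1 s1] /= [hr hs [-> ->]] ht [-> -> ->]; rewrite hr hs.
move=> /andP[hr hs] ht; exists ((r, s), t); split=> //.
by apply/allpairsP; exists (r, s).
Qed.

Lemma in_Q (k : int) (x : int * int * int) : (x \in Q k) = Qcond k x.
Proof.
have -> : (x \in Q k) = (x \in cube `|k|%N) && Qcond k x by rewrite in_fset.
apply/andb_idl; case: x => [[r s] t] /and4P[h1 h2 _ _].
rewrite mem_cube; lia.
Qed.

Definition P (k : int) : {fset int * int * int} := (Q (k + 1) `|` Q k)%fset.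

Definition covers (x' x : int * int * int) : bool :=
  let: (r', s', t') := x' in
  let: (r, s, t) := x in
  (t' == t + 1) && (`|r' - r| + `|s' - s| == 1).

(* Reflexive-transitive closure, inside P_k, of the covering relation. *)
Definition Ple (k : int) : rel (P k) :=
  connect (fun u v : P k => covers (val v) (val u)).

Definition J (k : int) : {set {set P k}} :=
  [set I : {set P k} |
    [forall v in I, forall u, Ple u v ==> (u \in I)]].

Definition ywt (n : nat) (hn : (0 < n)%N) (j : int) (x : int * int * int) :
    {fraction {mpoly rat[2 * n]}} :=
  let: (r, s, t) := x in y hn (3 * r + s + j).

(* Main.v *)
(** Write [G_k(w)] for the sum over order ideals of [P_k], with an arbitrary
    weight [w r s] on each element [(r, s, t)]. Intersect an ideal with [Q_k]
    to get a set [B]. Elements of the other layer of [P_k] ([Q_(k+1)]) are then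
    independent of each other: some are forced into the ideal by [B], some are
    not allowed, the others are free, so the sum over ideals with a given [B] is
    a product. The same holds for [P_(k-1)], whose other layer is [Q_(k-1)].
    Comparing the two products term by term gives
    [G_k(w) = (prod_i (1 + w(2i-k+1, 0))) * G_(k-1)(w')], where [w'] is the
    Y-system mutation of [w]. Under [w |-> w'] the recurrence at level [k] turns
    into the recurrence at level [k - 1] for [w'], so it follows by induction on
    [k] for all weights in a set of "positive" (in particular nonzero) elements
    stable under the field operations other than subtraction. *)

Require Import Defs.
From HB Require Import structures.
From mathcomp Require Import all_boot all_order all_algebra fraction finmap.
From mathcomp Require Import mpoly.
From mathcomp Require Import zify ring.

Set Implicit Arguments.
Unset Strict Implicit.
Unset Printing Implicit Defensive.

Import Order.TTheory GRing.Theory Num.Theory.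
Local Open Scope ring_scope.

(** * Order ideals of a two-layer poset *)

(** Read [c v u] as: [v] covers [u]. Once the part [B] in [Y] is fixed, the points of [X] are
    independent, as no two of them are related: [x] may be taken if all it covers in [Y] lies in
    [B], and may be left out if nothing in [B] covers it. Expanding the product lists these
    choices. *)
Lemma ideal_sum_split (R : comNzRingType) (T : finType) (X Y : {set T})
    (c : rel T) (f : T -> R) :
  [disjoint X & Y] ->
  {in X &, forall v u, ~~ c v u} -> {in Y &, forall v u, ~~ c v u} ->
  \sum_(I : {set T} | (I \subset X :|: Y) &&
      [forall v in I, forall u in X :|: Y, c v u ==> (u \in I)])
    \prod_(x in I) f x =
  \sum_(B : {set T} | B \subset Y) (\prod_(x in B) f x) *
    \prod_(x in X) (f x *+ [forall u in Y, c x u ==> (u \in B)]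
                    + (~~ [exists v in B, c v x])%:R).
Proof.
move=> dXY cX cY.
have dXYP x : x \in X -> x \in Y -> False by move/(disjointFr dXY)=> ->.
rewrite (partition_big (fun I => I :&: Y) (fun B => B \subset Y)) /=; last first.
  by move=> I _; exact: subsetIr.
apply: eq_bigr => B sBY.
rewrite (reindex_onto (fun A => A :|: B) (fun I => I :&: X)) /=; last first.
  move=> I /andP[/andP[/subsetP sI _] /eqP <-]; rewrite -setIUr.
  by apply/setIidPl/subsetP => x /sI.
pose U x := [forall u in Y, c x u ==> (u \in B)].
pose L x := [exists v in B, c v x].
(* With the summands 0 and 1 off [X], the product runs over the whole type and [bigA_distr] applies;
   a choice [A] not inside [X] contributes 0. *)
have -> : \prod_(x in X) (f x *+ U x + (~~ L x)%:R) =
    \prod_x ((if x \in X then f x *+ U x else 0) +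
             (if x \in X then (~~ L x)%:R else 1)).
  by rewrite big_mkcond; apply: eq_bigr => x _; case: ifP => _; rewrite ?add0r.
rewrite bigA_distr big_distrr /= big_mkcond /=; apply: eq_bigr => A _.
have UP x : reflect (forall u, u \in Y -> c x u -> u \in B) (U x).
  apply: (iffP forallP) => [h u uY cu|h u].
    by move: (h u); rewrite uY cu.
  by apply/implyP => uY; apply/implyP; exact: h.
have LP x : reflect (exists2 v, v \in B & c v x) (L x).
  apply: (iffP existsP) => [[v /andP[]]|[v vB cv]]; first by exists v.
  by exists v; rewrite vB.
(* [ok] says that no indicator in the term of [A] vanishes; this amounts to [A :|: B] being an ideal
   with parts [A] and [B]. *)
pose ok := [forall x, if x \in A then (x \in X) && U x else (x \in X) ==> ~~ L x].
set cond := (X in if X then _ else _).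
have -> : cond = ok.
  rewrite /cond -andbA.
  apply/idP/forallP => [/and3P[/andP[_ cl] /eqP eB /eqP eA] x|okA].
    have clP v u : v \in A :|: B -> u \in X :|: Y -> c v u -> u \in A :|: B.
      by move=> hv hu; move/forall_inP: cl => /(_ v hv)/forall_inP/(_ u hu)/implyP.
    case: ifP => xA.
      have xX : x \in X by move: xA; rewrite -eA inE => /andP[].
      rewrite xX; apply/UP => u uY cxu.
      have : u \in A :|: B by apply: clP cxu; rewrite inE ?xA ?uY ?orbT.
      by move=> uAB; rewrite -eB inE uAB.
    apply/implyP => xX; apply/LP => -[v vB cvx].
    have : x \in A :|: B by apply: clP cvx; rewrite inE ?vB ?xX ?orbT.
    rewrite inE xA /= => /(subsetP sBY); exact: dXYP.
  have sAX x : x \in A -> x \in X by move=> xA; move: (okA x); rewrite xA; case/andP.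
  have sBY' x : x \in B -> x \in Y by move/(subsetP sBY).
  apply/and3P; split.
  - rewrite setUSS //=; last by apply/subsetP.
    apply/forall_inP => v vAB; apply/forall_inP => u uXY; apply/implyP => cvu.
    move: vAB uXY; rewrite !inE => /orP[vA|vB] /orP[uX|uY].
    + by move: cvu; rewrite (negbTE (cX _ _ (sAX _ vA) uX)).
    + move: (okA v); rewrite vA => /andP[_ /UP/(_ u uY cvu) ->]; exact: orbT.
    + move: (okA u); case: ifP => // _; rewrite uX /= => /LP []; by exists v.
    + by move: cvu; rewrite (negbTE (cY _ _ (sBY' _ vB) uY)).
  - apply/eqP/setP => x; rewrite !inE; apply/andP/idP.
      by case=> /orP[/sAX h /(dXYP _ h)|].
    move=> h.
    by rewrite h orbT sBY'.
  - apply/eqP/setP => x; rewrite !inE; apply/andP/idP => [[/orP[//|/sBY' h1 h2]]|h].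
      by case: (dXYP _ h2 h1).
    by rewrite h sAX.
case: (boolP ok) => [/forallP okA|/forallPn[x nok]]; last first.
  rewrite [X in _ = _ * X](bigD1 x) //= mulrCA; move: nok.
  case: ifP => _; case: (x \in X) => //=; rewrite ?mul0r //.
    by move/negbTE->; rewrite mulr0n mul0r.
  by move/negbTE->; rewrite mul0r.
have sAX x : x \in A -> x \in X by move=> xA; move: (okA x); rewrite xA; case/andP.
have dAB : [disjoint A & B].
  by apply/pred0P => x /=; apply/negP => /andP[/sAX xX /(subsetP sBY)]; exact: dXYP.
rewrite (eq_bigl [predU A & B]) => [|x]; last by rewrite !inE.
rewrite bigU //=.
rewrite mulrC [X in _ = _ * X](bigID (fun x => x \in A)) /=.
rewrite [X in _ = _ * (_ * X)]big1 ?mulr1.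
  congr (_ * _); apply: eq_bigr => x xA.
  by move: (okA x); rewrite xA => /andP[-> ->].
move=> x /negbTE xA; move: (okA x); rewrite xA; case: (x \in X) => //= ->.
by [].
Qed.

(** * Ideals of [P_k] inside a common finite box *)

Local Arguments Qcond : simpl never.
Local Arguments covers : simpl never.

(** [P k] and [P (k - 1)] are different types; inside one box, the same set [B] of points of [Q_k]
    serves for both. *)
Definition box (N : nat) : {fset int * int * int} := [fset x in cube N]%fset.

Definition Qbox (N : nat) (k : int) : {set box N} :=
  [set x | Qcond k (val x)].

Lemma mem_box (N : nat) (r s t : int) :
  ((r, s, t) \in box N) = [&& `|r| <= N%:Z, `|s| <= N%:Z & `|t| <= N%:Z].
Proof. by rewrite -mem_cube in_fset. Qed.

(** Closure under single covering steps propagates along the paths that define [Ple]. *)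
Lemma mem_J (k : int) (I : {set P k}) :
  (I \in J k) =
  [forall v in I, forall u, covers (val v) (val u) ==> (u \in I)].
Proof.
rewrite inE; apply/forall_inP/forall_inP => h v vI; apply/forallP => u.
  apply/implyP => cvu; move/forallP: (h v vI) => /(_ u)/implyP; apply.
  exact: connect1.
apply/implyP => /connectP[p pth ev].
elim: p u pth ev => [u _ /= <- //|w p IHp u /= /andP[cwu pth] ev].
have wI := IHp w pth ev.
by move/forallP: (h w wI) => /(_ u)/implyP; apply.
Qed.

Lemma ideal_sum_box (R : comNzRingType) (k : int) (N : nat)
    (f : int * int * int -> R) : `|k| + 1 <= N%:Z ->
  \sum_(I in J k) \prod_(x in I) f (val x) =
  \sum_(I : {set box N} | (I \subset Qbox N (k + 1) :|: Qbox N k) &&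
      [forall v in I, forall u in Qbox N (k + 1) :|: Qbox N k,
         covers (val v) (val u) ==> (u \in I)])
    \prod_(x in I) f (val x).
Proof.
move=> hN.
have sub : (P k `<=` box N)%fset.
  apply/fsubsetP => -[[r s] t]; rewrite inE !in_Q mem_box => /orP[] /and4P[]; lia.
pose h := fincl sub.
have hinj : injective h by exact: fincl_inj.
have hP (x : P k) : h x \in Qbox N (k + 1) :|: Qbox N k.
  by rewrite !inE /= -!in_Q; have := valP x; rewrite inE.
have hS (x : box N) : x \in Qbox N (k + 1) :|: Qbox N k -> exists y, x = h y.
  rewrite !inE -!in_Q => xP.
  have xPk : val x \in P k by rewrite inE.
  by exists [` xPk]%fset; apply: val_inj.
rewrite [RHS](reindex_onto (fun I : {set P k} => h @: I)
  (fun I : {set box N} => h @^-1: I)) /=; last first.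
  move=> I /andP[/subsetP sI _]; apply/setP => x; apply/imsetP/idP => [[y]|xI].
    by rewrite inE => yI ->.
  by have [y ey] := hS _ (sI _ xI); exists y => //; rewrite inE -ey.
apply: eq_big => [I|I _]; last by rewrite big_imset //=; move=> x x' _ _ /hinj.
have -> : h @^-1: (h @: I) = I.
  by apply/setP => x; rewrite inE mem_imset.
rewrite eqxx andbT mem_J.
have -> : h @: I \subset Qbox N (k + 1) :|: Qbox N k.
  by apply/subsetP => _ /imsetP[x _ ->]; exact: hP.
apply/forall_inP/forall_inP => hI v.
  case/imsetP => x xI ->; apply/forall_inP => u /hS[z ->]; apply/implyP => c.
  rewrite mem_imset //; by move/forallP: (hI x xI) => /(_ z)/implyP; apply.
move=> vI; apply/forallP => u; apply/implyP => c.
have hvI : h v \in h @: I by rewrite mem_imset.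
by move/forall_inP: (hI _ hvI) => /(_ _ (hP u))/implyP/(_ c); rewrite mem_imset.
Qed.

(** * Products over the layers next to [Q_k] *)

(** The weight depends on [r] and [s] only; the shift [c] serves to bring different layers to a
    common height. *)
Lemma prod_box_shift (R : comNzRingType) (N : nat) (S : pred (int * int * int))
    (a b c : int) (g : int -> int -> R) :
  (forall r s t, S (r, s, t) ->
     ((r, s, t) \in box N) && ((r + a, s + b, t + c) \in box N)) ->
  \prod_(z <- box N | S z) g (z.1.1 + a) (z.1.2 + b) =
  \prod_(z <- box N | S (z.1.1 - a, z.1.2 - b, z.2 - c)) g z.1.1 z.1.2.
Proof.
move=> hS; pose sh (z : int * int * int) := (z.1.1 + a, z.1.2 + b, z.2 + c).
rewrite -big_filter -[RHS]big_filter.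
rewrite -(big_map sh xpredT (fun z => g z.1.1 z.1.2)).
apply: perm_big; apply: uniq_perm; [|exact/filter_uniq/fset_uniq|].
  rewrite map_inj_in_uniq ?filter_uniq ?fset_uniq // => -[[r s] t] [[r' s'] t'] _ _.
  by case=> /addIr-> /addIr-> /addIr->.
move=> [[r s] t]; rewrite mem_filter /=; apply/mapP/andP.
  case=> -[[r' s'] t']; rewrite mem_filter /= => /andP[Sz _] [-> -> ->].
  by rewrite !addrK; split=> //; case/andP: (hS _ _ _ Sz).
case=> Sz _; exists (r - a, s - b, t - c); last by rewrite /sh /= !subrK.
by rewrite mem_filter Sz; case/andP: (hS _ _ _ Sz).
Qed.

(* Given [B], a part of [Q_k]: an ideal of [P_k] meeting [Q_k] in [B] must contain
   the [forced_outer] points of [Q_(k+1)] and no point of [Q_(k+1)] that is not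
   [allowed_outer]; likewise [_inner] for ideals of [P_(k-1)] and [Q_(k-1)].
   Points of [Q_k] lie below their neighbours in [Q_(k+1)] in the [s] direction
   and above those in the [r] direction; for [Q_(k-1)] it is the other way. *)
Definition forced_outer (B : pred (int * int * int)) (z : int * int * int) :=
  let: (r, s, t) := z in B (r - 1, s, t + 1) || B (r + 1, s, t + 1).

Definition allowed_outer (k : nat) (B : pred (int * int * int))
    (z : int * int * int) :=
  let: (r, s, t) := z in
  (Qcond k (r, s - 1, t - 1) ==> B (r, s - 1, t - 1)) &&
  (Qcond k (r, s + 1, t - 1) ==> B (r, s + 1, t - 1)).

Definition forced_inner (B : pred (int * int * int)) (z : int * int * int) :=
  let: (r, s, t) := z in B (r, s - 1, t + 1) || B (r, s + 1, t + 1).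

Definition allowed_inner (B : pred (int * int * int)) (z : int * int * int) :=
  let: (r, s, t) := z in B (r - 1, s, t - 1) && B (r + 1, s, t - 1).

(** Let [p] and [q] be the values of [B] at [(r - 1, s, t)] and [(r + 1, s, t)]. The point
    [(r, s, t - 1)] is forced when [p || q], and [(r, s, t + 1)] is allowed when [p && q]; as many
    of these two hold as of [p] and [q]. *)
Lemma prod_forced_outer_allowed_inner (k N : nat) (B : pred (int * int * int))
    (hN : (k + 3 <= N)%N) (BQ : forall z, B z -> Qcond k z)
    (R : comNzRingType) (g : int -> int -> R) :
  (\prod_(z <- box N | Qcond (k%:Z + 1) z && forced_outer B z) g z.1.1 z.1.2) *
  (\prod_(z <- box N | Qcond (k%:Z - 1) z && allowed_inner B z) g z.1.1 z.1.2) =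
  \prod_(z <- box N | B z) (g (z.1.1 - 1) z.1.2 * g (z.1.1 + 1) z.1.2).
Proof.
have E (z : int * int * int) : g z.1.1 z.1.2 = g (z.1.1 + 0) (z.1.2 + 0).
  by rewrite !addr0.
have E1 (z : int * int * int) a : g (z.1.1 + a) z.1.2 = g (z.1.1 + a) (z.1.2 + 0).
  by rewrite !addr0.
rewrite big_split /=.
under eq_bigr do rewrite E.
under [X in _ * X = _]eq_bigr do rewrite E.
under [X in _ = X * _]eq_bigr do rewrite E1.
under [X in _ = _ * X]eq_bigr do rewrite E1.
(* The shifts index all four products by the same [(r, s, t)], with the points of [B] at height
   [t]. *)
rewrite (@prod_box_shift _ _ _ 0 0 1); last first.
  by move=> r s t /andP[/and4P[h1 h2 h3 h4] _]; rewrite !mem_box; lia.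
rewrite (@prod_box_shift _ _ _ 0 0 (-1)); last first.
  by move=> r s t /andP[/and4P[h1 h2 h3 h4] _]; rewrite !mem_box; lia.
rewrite (@prod_box_shift _ _ _ (-1) 0 0); last first.
  by move=> r s t /BQ/and4P[h1 h2 h3 h4]; rewrite !mem_box; lia.
rewrite (@prod_box_shift _ _ _ 1 0 0); last first.
  by move=> r s t /BQ/and4P[h1 h2 h3 h4]; rewrite !mem_box; lia.
rewrite big_mkcond [X in _ * X]big_mkcond [X in _ = X * _]big_mkcond.
rewrite [X in _ = _ * X]big_mkcond -!big_split /=.
apply: eq_bigr => -[[r s] t] _ /=; rewrite !opprK !subr0 !subrK addrK.
case Bm: (B (r - 1, s, t)); case Bp: (B (r + 1, s, t));
  rewrite ?andbF ?mulr1 ?mul1r //=.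
- have [/and4P[b1 b2 b3 b4] /and4P[b5 b6 b7 b8]] := (BQ _ Bm, BQ _ Bp).
  have -> : Qcond (k%:Z + 1) (r, s, t - 1) by apply/and4P; split; lia.
  have -> : Qcond (k%:Z - 1) (r, s, t + 1) by apply/and4P; split; lia.
  by [].
- have /and4P[b1 b2 b3 b4] := BQ _ Bm.
  have -> : Qcond (k%:Z + 1) (r, s, t - 1) by apply/and4P; split; lia.
  by [].
- have /and4P[b1 b2 b3 b4] := BQ _ Bp.
  have -> : Qcond (k%:Z + 1) (r, s, t - 1) by apply/and4P; split; lia.
  by [].
Qed.
(** The same count works in the [s] direction where both lower neighbours lie in [Q_k]. A point of
    [Q_(k+1)] with only one of them in [Q_k] is allowed when [B] contains that one; a point with
    none is always allowed. The latter are the [k] points [(2i - k + 1, 0, 1 - k)], which give the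
    extra product. *)
Lemma prod_allowed_outer_forced_inner (k N : nat) (B : pred (int * int * int))
    (hN : (k + 3 <= N)%N) (BQ : forall z, B z -> Qcond k z)
    (R : comNzRingType) (g : int -> int -> R) :
  (\prod_(z <- box N | Qcond (k%:Z + 1) z && allowed_outer k B z) g z.1.1 z.1.2) *
  (\prod_(z <- box N | Qcond (k%:Z - 1) z && forced_inner B z) g z.1.1 z.1.2) =
  (\prod_(0 <= i < k) g (2 * i%:Z - k%:Z + 1) 0) *
  \prod_(z <- box N | B z) (g z.1.1 (z.1.2 - 1) * g z.1.1 (z.1.2 + 1)).
Proof.
have E (z : int * int * int) : g z.1.1 z.1.2 = g (z.1.1 + 0) (z.1.2 + 0).
  by rewrite !addr0.
have E1 (z : int * int * int) a : g z.1.1 (z.1.2 + a) = g (z.1.1 + 0) (z.1.2 + a).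
  by rewrite !addr0.
(* [base] holds the points with no lower neighbour in [Q_k], moved from height [1 - k] to [- k] to
   match the shift of the outer product below. *)
pose base (z : int * int * int) := let: (r, s, t) := z in
  [&& s == 0, t == - k%:Z, `|r| <= k%:Z - 1 & (2 %| r - k%:Z + 1)%Z].
have -> : \prod_(0 <= i < k) g (2 * i%:Z - k%:Z + 1) 0 =
    \prod_(z <- box N | base z) g z.1.1 z.1.2.
  pose em (i : nat) : int * int * int := (2 * i%:Z - k%:Z + 1, 0, - k%:Z).
  rewrite -[RHS]big_filter -(big_map em xpredT (fun z => g z.1.1 z.1.2)).
  apply: perm_big; apply: uniq_perm; [|exact/filter_uniq/fset_uniq|].
    rewrite map_inj_in_uniq ?iota_uniq // => i i' _ _ []; lia.
  move=> [[r s] t]; rewrite mem_filter mem_box /=; apply/mapP/idP.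
    by case=> i; rewrite mem_iota => hi [-> -> ->]; lia.
  move=> /andP[/and4P[/eqP-> /eqP-> h1 h2] _].
  exists `|(r + k%:Z - 1) %/ 2|%Z%N; first by rewrite mem_iota; lia.
  by rewrite /em; congr (_, _, _); lia.
rewrite big_split /=.
under eq_bigr do rewrite E.
under [X in _ * X = _]eq_bigr do rewrite E.
under [X in _ = _ * (X * _)]eq_bigr do rewrite E1.
under [X in _ = _ * (_ * X)]eq_bigr do rewrite E1.
rewrite (@prod_box_shift _ _ _ 0 0 (-1)); last first.
  by move=> r s t /andP[/and4P[h1 h2 h3 h4] _]; rewrite !mem_box; lia.
rewrite (@prod_box_shift _ _ _ 0 0 1); last first.
  by move=> r s t /andP[/and4P[h1 h2 h3 h4] _]; rewrite !mem_box; lia.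
rewrite (@prod_box_shift _ _ _ 0 (-1) 0); last first.
  by move=> r s t /BQ/and4P[h1 h2 h3 h4]; rewrite !mem_box; lia.
rewrite (@prod_box_shift _ _ _ 0 1 0); last first.
  by move=> r s t /BQ/and4P[h1 h2 h3 h4]; rewrite !mem_box; lia.
rewrite big_mkcond [X in _ * X = _]big_mkcond [X in _ = X * _]big_mkcond.
rewrite [X in _ = _ * (X * _)]big_mkcond [X in _ = _ * (_ * X)]big_mkcond.
rewrite -!big_split /=.
apply: eq_bigr => -[[r s] t] _ /=; rewrite !opprK !subr0 !subrK addrK.
have BQm := BQ (r, s - 1, t); have BQp := BQ (r, s + 1, t).
have hbase : base (r, s, t) = [&& Qcond (k%:Z + 1) (r, s, t + 1),
    ~~ Qcond k (r, s - 1, t) & ~~ Qcond k (r, s + 1, t)].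
  by rewrite /base /Qcond; apply/idP/idP; lia.
have h1 : Qcond k (r, s - 1, t) -> Qcond (k%:Z + 1) (r, s, t + 1).
  by rewrite /Qcond; lia.
have h2 : Qcond k (r, s + 1, t) -> Qcond (k%:Z + 1) (r, s, t + 1).
  by rewrite /Qcond; lia.
have h3 : Qcond (k%:Z - 1) (r, s, t - 1) =
    Qcond k (r, s - 1, t) && Qcond k (r, s + 1, t).
  by rewrite /Qcond; apply/idP/idP; lia.
rewrite -/(base (r, s, t)) hbase h3; move: BQm BQp h1 h2.
case: (Qcond (k%:Z + 1) _); case: (Qcond k (r, s - 1, t));
case: (Qcond k (r, s + 1, t)); case: (B (r, s - 1, t)); case: (B (r, s + 1, t));
move=> i1 i2 i3 i4 /=; rewrite ?mulr1 ?mul1r //;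
first [by have := i1 isT | by have := i2 isT | by have := i3 isT | by have := i4 isT].
Qed.

(** A point [(r, s, t)] of one layer, forced and barred by two points of [Q_k], corresponds to
    [(r + e, s + d, t)] in the other layer, forced and barred by the same two points, where [e] and
    [d] are the unit steps towards them. *)
Lemma forced_not_allowed_exchange (k : nat) (B : pred (int * int * int))
    (BQ : forall z, B z -> Qcond k z) :
  (exists z, [&& Qcond (k%:Z + 1) z, forced_outer B z & ~~ allowed_outer k B z]) <->
  (exists z, [&& Qcond (k%:Z - 1) z, forced_inner B z & ~~ allowed_inner B z]).
Proof.
have Q1 r s t (e d : int) : `|e| = 1 -> `|d| = 1 -> Qcond k (r + e, s, t + 1) ->
    Qcond k (r, s + d, t - 1) -> Qcond (k%:Z - 1) (r + e, s + d, t).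
  by rewrite /Qcond; lia.
have Q2 r s t (e d : int) : `|e| = 1 -> `|d| = 1 -> Qcond (k%:Z - 1) (r, s, t) ->
    Qcond k (r + e, s, t - 1) && Qcond (k%:Z + 1) (r + e, s + d, t).
  by rewrite /Qcond; lia.
split=> -[[[r s] t] /and3P[Qz]] /=.
  have main e d : `|e| = 1 -> `|d| = 1 -> B (r + e, s, t + 1) ->
      ~~ (Qcond k (r, s + d, t - 1) ==> B (r, s + d, t - 1)) ->
      exists z, [&& Qcond (k%:Z - 1) z, forced_inner B z & ~~ allowed_inner B z].
    move=> he hd Bz; rewrite negb_imply => /andP[Qu nB].
    have Qz' := Q1 r s t e d he hd (BQ _ Bz) Qu.
    exists (r + e, s + d, t); rewrite Qz' /=; apply/andP; split.
      have [ed | ed] : d = 1 \/ d = -1 by lia.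
        by rewrite ed addrK Bz.
      by rewrite ed subrK Bz orbT.
    have [ee | ee] : e = 1 \/ e = -1 by lia.
      by rewrite ee addrK (negbTE nB).
    by rewrite ee subrK (negbTE nB) andbF.
  by rewrite negb_and => /orP[] Bz /orP[] nB; apply: main Bz nB.
have main e d : `|e| = 1 -> `|d| = 1 -> B (r, s + d, t + 1) ->
    ~~ B (r + e, s, t - 1) ->
    exists z, [&& Qcond (k%:Z + 1) z, forced_outer B z & ~~ allowed_outer k B z].
  move=> he hd Bz nB; have /andP[Qu Qz'] := Q2 r s t e d he hd Qz.
  exists (r + e, s + d, t); rewrite Qz' /=; apply/andP; split.
    have [ee | ee] : e = 1 \/ e = -1 by lia.
      by rewrite ee addrK Bz.
    by rewrite ee subrK Bz orbT.
  have [ed | ed] : d = 1 \/ d = -1 by lia.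
    by rewrite ed addrK Qu (negbTE nB).
  by rewrite ed subrK Qu (negbTE nB) andbF.
by rewrite negb_and => /orP[] Bz /orP[] nB; apply: main Bz nB.
Qed.

(** * One mutation step for the sum over ideals *)

Lemma parity_Qcond (k r s t : int) : Qcond k (r, s, t) -> (2 %| r + s - k)%Z.
Proof. by rewrite /Qcond; lia. Qed.

(** By the congruences mod 4, the sign of [t' - t] decides the parity of [r' - r], hence whether a
    covering step goes along [r] or along [s]. *)
Lemma covers_outer (k r s t r' s' t' : int) :
  Qcond (k + 1) (r, s, t) -> Qcond k (r', s', t') ->
  (covers (r, s, t) (r', s', t') =
     [&& r' == r, t' == t - 1 & (s' == s - 1) || (s' == s + 1)]) *
  (covers (r', s', t') (r, s, t) =
     [&& s' == s, t' == t + 1 & (r' == r - 1) || (r' == r + 1)]).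
Proof. by rewrite /Qcond /covers => h1 h2; split; apply/idP/idP; lia. Qed.

Lemma covers_inner (k r s t r' s' t' : int) :
  Qcond (k - 1) (r, s, t) -> Qcond k (r', s', t') ->
  (covers (r, s, t) (r', s', t') =
     [&& s' == s, t' == t - 1 & (r' == r - 1) || (r' == r + 1)]) *
  (covers (r', s', t') (r, s, t) =
     [&& r' == r, t' == t + 1 & (s' == s - 1) || (s' == s + 1)]).
Proof. by rewrite /Qcond /covers => h1 h2; split; apply/idP/idP; lia. Qed.

(** A forced point contributes [w z], a free one [1 + w z], an excluded one 1; the implication from
    [low] to [up] rules out the factor 0. *)
Lemma prod_interval (K : fieldType) (N : nat) (C up low : pred (int * int * int))
    (w : int * int * int -> K) :
  (forall z, C z -> low z -> up z) -> (forall z, 1 + w z != 0) ->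
  \prod_(z <- box N | C z) (w z *+ up z + (~~ low z)%:R) =
  (\prod_(z <- box N | C z && low z) w z) *
  (\prod_(z <- box N | C z && up z) (1 + w z)) /
  \prod_(z <- box N | C z && low z) (1 + w z).
Proof.
move=> lu v0; rewrite !big_mkcondr -big_split -prodf_div /=.
apply: eq_bigr => z Cz; have := lu z Cz.
case: (low z) => [/(_ isT)->|_] /=; first by rewrite mulfK // addr0.
by case: (up z); rewrite /= mul1r divr1 ?add0r // addrC.
Qed.

(* The weights one step later in the Y-system. *)
Definition mutate2 (K : fieldType) (k : int) (w : int -> int -> K)
    (r s : int) : K :=
  if (2 %| r + s - k)%Z then
    w r s * (w (r - 1) s * w (r + 1) s) *
    ((1 + w r (s - 1)) * (1 + w r (s + 1))) /
    ((1 + w (r - 1) s) * (1 + w (r + 1) s))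
  else (w r s)^-1.

(** If some point is forced but not allowed, both sides vanish by the exchange lemma. Otherwise
    [prod_interval] applies on both sides, and the neighbour factors of [mutate2] over [B] become
    products over the two adjacent layers. *)
Lemma ideal_term_mutate (K : fieldType) (k N : nat) (B : pred (int * int * int))
    (w : int -> int -> K) :
  (k + 3 <= N)%N -> (forall z, B z -> Qcond k z) ->
  (forall r s, w r s != 0) -> (forall r s, 1 + w r s != 0) ->
  (\prod_(z <- box N | B z) w z.1.1 z.1.2) *
  \prod_(z <- box N | Qcond (k%:Z + 1) z)
    (w z.1.1 z.1.2 *+ allowed_outer k B z + (~~ forced_outer B z)%:R) =
  (\prod_(0 <= i < k) (1 + w (2 * i%:Z - k%:Z + 1) 0)) *
  ((\prod_(z <- box N | B z) mutate2 k w z.1.1 z.1.2) *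
   \prod_(z <- box N | Qcond (k%:Z - 1) z)
     (mutate2 k w z.1.1 z.1.2 *+ allowed_inner B z + (~~ forced_inner B z)%:R)).
Proof.
move=> hN BQ w0 v0.
have inbox (c : int) z : `|c| <= k%:Z + 1 -> Qcond c z -> z \in (box N : seq _).
  by case: z => [[r s] t] hc Qz; rewrite mem_box; move: Qz; rewrite /Qcond; lia.
(* On [Q_(k-1)] the parity of [r + s] is opposite to that of [k], so the mutation is an
   inversion. *)
have w'E z : Qcond (k%:Z - 1) z -> mutate2 k w z.1.1 z.1.2 = (w z.1.1 z.1.2)^-1.
  case: z => [[r s] t] /parity_Qcond /= h; rewrite /mutate2; case: ifP => //; lia.
rewrite [X in _ = _ * (_ * X)](eq_bigr (fun z =>
  (w z.1.1 z.1.2)^-1 *+ allowed_inner B z + (~~ forced_inner B z)%:R)); last by move=> z /w'E->.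
have exch := forced_not_allowed_exchange BQ.
have [/existsP|nadm] := boolP [exists x : box N,
    [&& Qcond (k%:Z + 1) (val x), forced_outer B (val x)
      & ~~ allowed_outer k B (val x)]].
  move=> [x /and3P[Qx lx ux]].
  have [|z /and3P[Qz lz uz]] := exch.1; first by exists (val x); rewrite Qx lx.
  have zb : z \in (box N : seq _) by apply: inbox Qz; lia.
  rewrite [X in _ * X = _](big_rem (val x)) ?(valP x) //= Qx lx (negbTE ux).
  rewrite [X in _ = _ * (_ * X)](big_rem z) //= Qz lz (negbTE uz).
  by rewrite !addr0 !mul0r !mulr0.
have lu z : Qcond (k%:Z + 1) z -> forced_outer B z -> allowed_outer k B z.
  move=> Qz lz; apply: contraNT nadm => uz.
  have zb : z \in box N by apply: inbox Qz; lia.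
  by apply/existsP; exists [` zb]%fset; rewrite Qz lz.
have lu' z : Qcond (k%:Z - 1) z -> forced_inner B z -> allowed_inner B z.
  move=> Qz lz; apply: contraNT nadm => uz.
  have [|x /and3P[Qx lx ux]] := exch.2; first by exists z; rewrite Qz lz.
  have xb : x \in box N by apply: inbox Qx; lia.
  by apply/existsP; exists [` xb]%fset; rewrite Qx lx.
rewrite (prod_interval N (w := fun z => w z.1.1 z.1.2) lu) //.
rewrite (prod_interval N (w := fun z => (w z.1.1 z.1.2)^-1) lu'); last first.
  by move=> z; rewrite -(mulVf (w0 z.1.1 z.1.2)) -[X in _ + X]mulr1 -mulrDr
    mulf_neq0 ?invr_eq0 // addrC.
have E (z : int * int * int) :
    1 + (w z.1.1 z.1.2)^-1 = (1 + w z.1.1 z.1.2) / w z.1.1 z.1.2.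
  by rewrite mulrDl mul1r divff // addrC.
rewrite [X in _ = _ * (_ * (_ * X / _))](eq_bigr _ (fun z _ => E z)).
rewrite [X in _ = _ * (_ * (_ / X))](eq_bigr _ (fun z _ => E z)).
have -> : \prod_(z <- box N | B z) mutate2 k w z.1.1 z.1.2 =
  (\prod_(z <- box N | B z) w z.1.1 z.1.2) *
  (\prod_(z <- box N | B z) (w (z.1.1 - 1) z.1.2 * w (z.1.1 + 1) z.1.2)) *
  (\prod_(z <- box N | B z)
     ((1 + w z.1.1 (z.1.2 - 1)) * (1 + w z.1.1 (z.1.2 + 1)))) /
  \prod_(z <- box N | B z) ((1 + w (z.1.1 - 1) z.1.2) * (1 + w (z.1.1 + 1) z.1.2)).
  rewrite -!big_split -prodf_div; apply: eq_bigr => -[[r s] t] /BQ/parity_Qcond h.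
  by rewrite /mutate2 h.
rewrite -(prod_forced_outer_allowed_inner hN BQ w).
rewrite -(prod_forced_outer_allowed_inner hN BQ (fun r s => 1 + w r s)).
have := prod_allowed_outer_forced_inner hN BQ (fun r s => 1 + w r s).
rewrite !prodf_div prodfV.
have nz (C : pred _) (f : int -> int -> K) : (forall r s, f r s != 0) ->
  \prod_(z <- box N | C z) f z.1.1 z.1.2 != 0.
  by move=> f0; rewrite prodf_seq_neq0; apply/allP => z _; rewrite f0 implybT.
have := nz (fun z => Qcond (k%:Z + 1) z && forced_outer B z) _ v0.
have := nz (fun z => Qcond (k%:Z - 1) z && forced_inner B z) _ v0.
have := nz (fun z => Qcond (k%:Z - 1) z && allowed_inner B z) _ v0.
have := nz (fun z => Qcond (k%:Z - 1) z && forced_inner B z) _ w0.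
have := nz (fun z => Qcond (k%:Z - 1) z && allowed_inner B z) _ w0.
set U'w := \prod_(z <- _ | _) _; set L'w := \prod_(z <- _ | _) _.
set U'v := \prod_(z <- _ | _) _; set L'v := \prod_(z <- _ | _) _.
set Lv := \prod_(z <- _ | _) _; move=> n1 n2 n3 n4 n5.
set Uv := \prod_(z <- _ | _) _; set pr := \prod_(0 <= i < k) _.
set Be := \prod_(z <- _ | _) _; set Bw := \prod_(z <- _ | _) _.
set Lw := \prod_(z <- _ | _) _ => e.
(* Regrouping isolates [pr * Be], which [e] turns into the products of [1 + w] over allowed outer
   and forced inner points. *)
rewrite [RHS](_ : _ = Bw * Lw * U'w * (pr * Be) / (Lv * U'v) *
  (L'w^-1 * (U'v / U'w) / (L'v / L'w))); last by ring.
rewrite -e; field.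
by rewrite n1 n2 n3 n4.
Qed.

Lemma ideal_sum_mutate2 (K : fieldType) (k : nat) (w : int -> int -> K) :
  (forall r s, w r s != 0) -> (forall r s, 1 + w r s != 0) ->
  \sum_(I in J k) \prod_(x in I) w (val x).1.1 (val x).1.2 =
  (\prod_(0 <= i < k) (1 + w (2 * i%:Z - k%:Z + 1) 0)) *
  \sum_(I in J (k%:Z - 1))
    \prod_(x in I) mutate2 k w (val x).1.1 (val x).1.2.
Proof.
move=> w0 v0; pose N := (k + 3)%N.
have noncov (c : int) : {in Qbox N c &, forall v u, ~~ covers (val v) (val u)}.
  move=> v u; rewrite !inE; case: (val v) => [[r s] t]; case: (val u) => [[r' s'] t'].
  by rewrite /Qcond /covers; lia.
have disj (c d : int) : c = d + 1 -> [disjoint Qbox N c & Qbox N d].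
  move=> ->; apply/pred0P => x /=; rewrite !inE; case: (val x) => [[r s] t].
  by apply/negP => /andP[/parity_Qcond + /parity_Qcond]; lia.
rewrite (@ideal_sum_box _ _ N (fun z => w z.1.1 z.1.2)); last by lia.
rewrite (@ideal_sum_box _ _ N (fun z => mutate2 k w z.1.1 z.1.2)); last by lia.
(* The shared layer [Q_k] has to be the second set of each union, where [ideal_sum_split] takes
   [B]. *)
rewrite subrK [Qbox N k :|: Qbox N (k%:Z - 1)]setUC.
rewrite !(ideal_sum_split (c := fun v u : box N => covers (val v) (val u)));
  try exact: noncov; try (by apply: disj; lia).
  2: by rewrite disjoint_sym; apply: disj; lia.
rewrite big_distrr; apply: eq_bigr => B sB /=.
(* [Bp] is [B] as a predicate on all triples, the form that [ideal_term_mutate] takes. *)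
pose Bp z := [exists x in B, val x == z].
have BpP z : reflect (exists2 x : box N, x \in B & val x = z) (Bp z).
  apply: (iffP existsP) => [[x /andP[xB /eqP ez]]|[x xB ez]]; first by exists x.
  by exists x; rewrite xB ez eqxx.
have BpE (x : box N) : Bp (val x) = (x \in B).
  by apply/BpP/idP => [[x' x'B /val_inj <-]|xB] //; exists x.
have BQ z : Bp z -> Qcond k z.
  by case/BpP => x /(subsetP sB) + <-; rewrite inE.
have upP (x : box N) : reflect (forall z, Qcond k z -> covers (val x) z -> Bp z)
    [forall u in Qbox N k, covers (val x) (val u) ==> (u \in B)].
  apply: (iffP forall_inP) => h.
    move=> z Qz cz; have zb : z \in box N.
      by case: z Qz {cz} => [[r s] t]; rewrite mem_box /Qcond; lia.
    have := h [` zb]%fset; rewrite inE => /(_ Qz)/implyP/(_ cz).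
    by rewrite -BpE.
  by move=> u; rewrite inE => Qu; apply/implyP => /(h _ Qu); rewrite BpE.
have lowP (x : box N) : reflect (exists2 z, Bp z & covers z (val x))
    [exists v in B, covers (val v) (val x)].
  apply: (iffP existsP) => [[v /andP[vB cv]]|[z /BpP[v vB <-] cv]].
    by exists (val v); rewrite ?BpE.
  by exists v; rewrite vB.
have := ideal_term_mutate (leqnn N) BQ w0 v0.
rewrite !big_seq_fsetE.
rewrite (eq_bigl _ _ BpE) [X in _ = _ * (X * _)](eq_bigl _ _ BpE) => e.
have inQ (c : int) (x : box N) : (x \in Qbox N c) = Qcond c (val x) by rewrite inE.
rewrite (eq_bigl _ _ (inQ _)) [X in _ = _ * (_ * X)](eq_bigl _ _ (inQ _)).
rewrite [X in _ * X = _](eq_bigr (fun x : box N => w (val x).1.1 (val x).1.2 *+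
  allowed_outer k Bp (val x) + (~~ forced_outer Bp (val x))%:R)); last first.
  move=> x Qx; congr (_ *+ nat_of_bool _ + (~~ _)%:R).
    apply/upP/idP; case: (val x) Qx => [[r s] t] Qx /=.
      move=> h; apply/andP; split; apply/implyP => Qz; apply: h => //;
        by rewrite (covers_outer Qx Qz) ?eqxx ?orbT.
    move=> /andP[/implyP h1 /implyP h2] [[r' s'] t'] Qz.
    rewrite (covers_outer Qx Qz) => /and3P[/eqP er /eqP et /orP[]/eqP es];
      move: Qz; rewrite er et es; [exact: h1|exact: h2].
  apply/lowP/idP; case: (val x) Qx => [[r s] t] Qx /=.
    move=> [[[r' s'] t'] Bz]; rewrite (covers_outer Qx (BQ _ Bz)).
    by move=> /and3P[/eqP es /eqP et /orP[]/eqP er]; move: Bz; rewrite er et es => ->;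
      rewrite ?orbT.
  by move=> /orP[] Bz; [exists (r - 1, s, t + 1)|exists (r + 1, s, t + 1)] => //;
    rewrite (covers_outer Qx (BQ _ Bz)) !eqxx ?orbT.
rewrite e; congr (_ * (_ * _)); apply: eq_bigr => x Qx.
congr (_ *+ nat_of_bool _ + (~~ _)%:R).
  apply/idP/upP; case: (val x) Qx => [[r s] t] Qx /=.
    move=> /andP[h1 h2] [[r' s'] t'] Qz; rewrite (covers_inner Qx Qz).
    by move=> /and3P[/eqP es /eqP et /orP[]/eqP er]; rewrite er et es.
  have [Q1 Q2] : Qcond k (r - 1, s, t - 1) /\ Qcond k (r + 1, s, t - 1).
    by move: Qx; rewrite /Qcond; lia.
  by move=> h; rewrite !h // (covers_inner Qx) ?eqxx ?orbT.
apply/idP/lowP; case: (val x) Qx => [[r s] t] Qx /=.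
  by move=> /orP[] Bz; [exists (r, s - 1, t + 1)|exists (r, s + 1, t + 1)] => //;
    rewrite (covers_inner Qx (BQ _ Bz)) !eqxx ?orbT.
move=> [[[r' s'] t'] Bz]; rewrite (covers_inner Qx (BQ _ Bz)).
by move=> /and3P[/eqP er /eqP et /orP[]/eqP es]; move: Bz; rewrite er et es => ->;
  rewrite ?orbT.
Qed.

(** * Weights depending on the single index [3r + s + j] *)

Definition ideal_sum (K : fieldType) (u : int -> K) (j k : int) : K :=
  \sum_(I in J k)
    \prod_(x in I) u (3 * (val x).1.1 + (val x).1.2 + j).

(** This is [mutate2] in one index: a unit step in [r] moves it by 3, one in [s] by 1. Only the
    parity of [c] matters. *)
Definition mutate (K : fieldType) (c : int) (u : int -> K) (m : int) : K :=
  if (2 %| m - c)%Z then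
    u m * (u (m - 3) * u (m + 3)) * ((1 + u (m - 1)) * (1 + u (m + 1))) /
    ((1 + u (m - 3)) * (1 + u (m + 3)))
  else (u m)^-1.

Lemma ideal_sum_mutate (K : fieldType) (u : int -> K) (j : int) (k : nat) :
  (forall m, u m != 0) -> (forall m, 1 + u m != 0) ->
  ideal_sum u j k =
  (\prod_(0 <= i < k) (1 + u (j + 3 * (2 * i%:Z - k%:Z + 1)))) *
  ideal_sum (mutate (j + k%:Z) u) j (k%:Z - 1).
Proof.
move=> u0 v0; rewrite /ideal_sum.
rewrite (@ideal_sum_mutate2 K k (fun r s => u (3 * r + s + j))) //.
congr (_ * _).
  by apply: eq_bigr => i _; congr (1 + u _); lia.
apply: eq_bigr => I _; apply: eq_bigr => x _; rewrite /mutate2 /mutate.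
move: (val x).1.1 (val x).1.2 => r s.
have -> : (2 %| 3 * r + s + j - (j + k%:Z))%Z = (2 %| r + s - k%:Z)%Z.
  by apply/idP/idP; lia.
have -> : 3 * (r - 1) + s + j = 3 * r + s + j - 3 by lia.
have -> : 3 * (r + 1) + s + j = 3 * r + s + j + 3 by lia.
have -> : 3 * r + (s - 1) + j = 3 * r + s + j - 1 by lia.
by have -> : 3 * r + (s + 1) + j = 3 * r + s + j + 1 by lia.
Qed.

(** A point of [Q_k] has [|r| + |s| <= k - 2], so [P_(-1)] is empty and has only the empty ideal. *)
Lemma ideal_sum_m1 (K : fieldType) (u : int -> K) (j : int) :
  ideal_sum u j (-1) = 1.
Proof.
have noP (x : P (-1)) : False.
  have := valP x; rewrite inE !in_Q; case: (val x) => [[r s] t].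
  by rewrite /Qcond; lia.
rewrite /ideal_sum (big_pred1 set0) ?big_set0 // => I.
have -> : I = set0 by apply/setP => x; case: (noP x).
by rewrite /= eqxx mem_J; apply/forall_inP => v; rewrite inE.
Qed.

Lemma ideal_sum_0 (K : fieldType) (u : int -> K) (j : int) :
  (forall m, u m != 0) -> (forall m, 1 + u m != 0) -> ideal_sum u j 0 = 1.
Proof.
by move=> u0 v0; rewrite (ideal_sum_mutate j 0 u0 v0) big_nil ideal_sum_m1 mulr1.
Qed.

Lemma eq_mutate (K : fieldType) (c d : int) (u : int -> K) :
  (2 %| c - d)%Z -> mutate c u =1 mutate d u.
Proof.
move=> h m; rewrite /mutate.
by have -> : (2 %| m - c)%Z = (2 %| m - d)%Z by apply/idP/idP; lia.
Qed.

Lemma eq_ideal_sum (K : fieldType) (u u' : int -> K) (j k : int) :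
  u =1 u' -> ideal_sum u j k = ideal_sum u' j k.
Proof. by move=> h; do 2!apply: eq_bigr => ? _; rewrite h. Qed.

(** In the coefficient of the recurrence, [mutate] treats even and odd places differently. *)
Lemma prod_nat_odd (R : comNzRingType) (z : nat -> R) (k : nat) :
  \prod_(0 <= i < (2 * k).+1) z i =
  (\prod_(0 <= i < k.+1) z (2 * i)%N) * \prod_(0 <= i < k) z (2 * i).+1.
Proof.
elim: k => [|k IH]; first by rewrite !big_nat1 big_nil mulr1.
have -> : (2 * k.+1).+1 = (2 * k).+3 by lia.
rewrite (big_nat_recr (2 * k).+2) // (big_nat_recr (2 * k).+1) //= IH.
rewrite (big_nat_recr k.+1 0 (fun i => z (2 * i)%N)) //=.
rewrite (big_nat_recr k 0 (fun i => z (2 * i).+1)) //= mulnS.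
by ring.
Qed.

(** This matches the coefficient of the recurrence with the prefactors of [ideal_sum_mutate]. At
    even places the denominators cancel the first two products and the numerators supply the last
    two; the inverses at odd places cancel the values of [u] that occur twice. *)
Lemma prod_mutate (K : fieldType) (u : int -> K) (j : int) (k : nat) :
  (forall m, u m != 0) -> (forall m, 1 + u m != 0) ->
  (\prod_(0 <= i < k.+1) (1 + u (j - 3 + 3 * (2 * i%:Z - k.+1%:Z + 1)))) *
  (\prod_(0 <= i < k.+1) (1 + u (j + 3 + 3 * (2 * i%:Z - k.+1%:Z + 1)))) *
  (\prod_(0 <= i < (2 * k).+1) mutate (j + k%:Z) u (j + 3 * (i%:Z - k%:Z))) =
  (\prod_(0 <= i < (2 * k.+1).+1) u (j + 3 * (i%:Z - k.+1%:Z))) *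
  ((\prod_(0 <= i < k.+1) (1 + u (j - 1 + 3 * (2 * i%:Z - k.+1%:Z + 1)))) *
  (\prod_(0 <= i < k.+1) (1 + u (j + 1 + 3 * (2 * i%:Z - k.+1%:Z + 1))))).
Proof.
move=> u0 v0.
(* [z i] is place [i] of the coefficient at level [k.+1]. Place [2 * i] at level [k] has index
   [m i], which is that of [z (2 * i).+1]. *)
pose z i := u (j + 3 * (i%:Z - k.+1%:Z)).
pose m i := j + 3 * (2 * i%:Z - k%:Z).
have nzprod (f : nat -> K) n : (forall i, f i != 0) -> \prod_(0 <= i < n) f i != 0.
  by move=> f0; rewrite prodf_seq_neq0; apply/allP => i _; rewrite f0.
have eA c : \prod_(0 <= i < k.+1) (1 + u (j + c + 3 * (2 * i%:Z - k.+1%:Z + 1))) =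
    \prod_(0 <= i < k.+1) (1 + u (m i + c)).
  by apply: eq_bigr => i _; congr (1 + u _); rewrite /m; lia.
rewrite !eA prod_nat_odd [in RHS]prod_nat_odd.
rewrite [X in _ * _ * (X * _)](eq_bigr (fun i => z (2 * i).+1 *
  (z (2 * i)%N * z (2 * i).+2) * ((1 + u (m i - 1)) * (1 + u (m i + 1))) /
  ((1 + u (m i - 3)) * (1 + u (m i + 3))))); last first.
  move=> i _; rewrite /mutate.
  have -> : j + 3 * ((2 * i)%N%:Z - k%:Z) = m i by rewrite /m; lia.
  have -> : (2 %| m i - (j + k%:Z))%Z by rewrite /m; lia.
  by congr (_ * _ / _); congr (u _ * (u _ * u _)); rewrite /m; lia.
rewrite [X in _ * _ * (_ * X)](eq_bigr (fun i => (z (2 * i).+2)^-1)); last first.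
  move=> i _; rewrite /mutate /z; case: ifP; first by lia.
  by move=> _; congr (u _)^-1; lia.
rewrite -/(z _) prodf_div !big_split prodfV /=.
rewrite (big_nat_recr k 0 (fun i => z (2 * i).+2)) //=.
rewrite (big_nat_recr k.+1 0 (fun i => z (2 * i)%N)) //=.
have -> : (2 * k.+1 = (2 * k).+2)%N by lia.
have n1 := nzprod (fun i => 1 + u (m i - 3)) k.+1 (fun i => v0 _).
have n2 := nzprod (fun i => 1 + u (m i + 3)) k.+1 (fun i => v0 _).
have n3 := nzprod (fun i => z (2 * i).+2) k (fun i => u0 _).
by field; rewrite n1 n2 n3.
Qed.

(** * The recurrence for positive weights *)

(** Nonvanishing of [u] and [1 + u] need not pass to [mutate c u]; membership in such a set does,
    and it implies both. *)
Definition positive_cone (K : fieldType) (pos : K -> Prop) : Prop :=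
  [/\ ~ pos 0, pos 1, forall x y, pos x -> pos y -> pos (x + y),
      forall x y, pos x -> pos y -> pos (x * y) & forall x, pos x -> pos x^-1].

Lemma mutate_positive (K : fieldType) (pos : K -> Prop) (c : int) (u : int -> K) :
  positive_cone pos -> (forall m, pos (u m)) -> forall m, pos (mutate c u m).
Proof.
move=> [_ pos1 posD posM posV] pu m.
have pv l : pos (1 + u l) by exact: posD.
rewrite /mutate; case: ifP => _; last exact/posV/pu.
by apply: (posM); [do 2!apply: (posM)|apply: (posV)] => //; apply: (posM).
Qed.

Lemma ideal_sum_recurrence (K : fieldType) (pos : K -> Prop) (u : int -> K)
    (j : int) (k : nat) :
  positive_cone pos -> (forall m, pos (u m)) ->
  ideal_sum u j (k%:Z + 1) * ideal_sum u j (k%:Z - 1) =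
  ideal_sum u (j - 3) k * ideal_sum u (j + 3) k +
  (\prod_(0 <= i < (2 * k).+1) u (j + 3 * (i%:Z - k%:Z))) *
    ideal_sum u (j - 1) k * ideal_sum u (j + 1) k.
Proof.
move=> cone; have [pos0 pos1 posD _ _] := cone.
have nz x : pos x -> x != 0 by move=> h; apply/eqP => e; case: pos0; rewrite -e.
elim: k u j => [|k IH] u j pu.
  (* The sums at levels -1 and 0 are 1, and the one at level 1 is [1 + u j]. *)
  have u0 m : u m != 0 by exact: nz.
  have v0 m : 1 + u m != 0 by apply/nz/posD.
  rewrite ideal_sum_m1 !ideal_sum_0 // (ideal_sum_mutate j 1 u0 v0).
  have pu' m : pos (mutate (j + 1) u m).
    exact: mutate_positive cone pu m.
  rewrite subrr ideal_sum_0; last first.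
  - by move=> m; apply/nz/posD.
  - by move=> m; apply: nz.
  by rewrite !big_nat1 !mulr1; congr (1 + u _); lia.
have u0 m : u m != 0 by exact: nz.
have v0 m : 1 + u m != 0 by apply/nz/posD.
pose u' := mutate (j + k%:Z) u.
have pu' m : pos (u' m).
  exact: mutate_positive cone pu m.
(* One mutation serves every sum: the level plus the starting index always has the parity of
   [j + k], since 1 and 3 are odd. *)
have step i (n : nat) : (2 %| i + n%:Z - (j + k%:Z))%Z -> ideal_sum u i n =
    (\prod_(0 <= l < n) (1 + u (i + 3 * (2 * l%:Z - n%:Z + 1)))) *
    ideal_sum u' i (n%:Z - 1).
  by move=> h; rewrite ideal_sum_mutate // (eq_ideal_sum _ _ (eq_mutate u h)).
have -> : k.+1%:Z + 1 = k.+2 by lia.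
have -> : k.+1%:Z - 1 = k by lia.
rewrite !step; try lia.
have -> : k.+2%:Z - 1 = k%:Z + 1 by lia.
have -> : k.+1%:Z - 1 = k by lia.
pose a (i : nat) := 1 + u (j + 3 * (2 * i%:Z - k.+2%:Z + 1)).
have e1 : \prod_(0 <= l < k) (1 + u (j + 3 * (2 * l%:Z - k%:Z + 1))) =
    \prod_(0 <= i < k) a i.+1.
  by apply: eq_bigr => i _; congr (1 + u _); lia.
have e2 : \prod_(0 <= l < k.+1) (1 + u (j - 3 + 3 * (2 * l%:Z - k.+1%:Z + 1))) =
    \prod_(0 <= i < k.+1) a i.
  by apply: eq_bigr => i _; congr (1 + u _); lia.
have e3 : \prod_(0 <= l < k.+1) (1 + u (j + 3 + 3 * (2 * l%:Z - k.+1%:Z + 1))) =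
    \prod_(0 <= i < k.+1) a i.+1.
  by apply: eq_bigr => i _; congr (1 + u _); lia.
(* Both sides equal the product of [a 0], ..., [a k.+1] times that of [a 1], ..., [a k]. So the left
   side of the recurrence and its first term on the right have the same prefactor. *)
have e4 : (\prod_(0 <= i < k.+2) a i) * (\prod_(0 <= i < k) a i.+1) =
    (\prod_(0 <= i < k.+1) a i) * (\prod_(0 <= i < k.+1) a i.+1).
  rewrite (big_nat_recr k.+1) // (big_nat_recr k 0 (fun i => a i.+1)) //=.
  by rewrite -!mulrA [a _ * _]mulrC.
have e5 := prod_mutate j k u0 v0; move: (IH u' j pu') e5.
rewrite -/(u') mulrACA e1 e4 e2 e3 => ->.
set C := \prod_(0 <= i < (2 * k).+1) _.
set a1 := \prod_(0 <= i < k.+1) a i; set a2 := \prod_(0 <= i < k.+1) a i.+1.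
move=> e5; rewrite mulrDr; congr (_ + _); first by rewrite mulrACA.
rewrite -!mulrA [a1 * _]mulrA; rewrite !mulrA e5. ring.
Qed.

(* The all-ones evaluation point makes every [y_j] positive. *)
Definition frac_pos (n : nat) (x : {fraction {mpoly rat[n]}}) : Prop :=
  exists p q : {mpoly rat[n]},
    [/\ 0 < p.@[fun=> 1], 0 < q.@[fun=> 1] & x = tofrac p / tofrac q].

(** Evaluation is a ring morphism, and a polynomial with positive value at a point is nonzero, hence
    a legitimate denominator. *)
Lemma frac_pos_cone (n : nat) : positive_cone (@frac_pos n).
Proof.
have nz (p : {mpoly rat[n]}) : 0 < p.@[fun=> 1] -> tofrac p != 0.
  by rewrite tofrac_eq0; apply: contraTneq => ->; rewrite meval0 ltxx.
split.
- case=> p [q [p0 q0 /esym/eqP]].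
  by rewrite mulf_eq0 invr_eq0 (negbTE (nz _ p0)) (negbTE (nz _ q0)).
- by exists 1, 1; rewrite meval1 ltr01 !tofrac1 divr1.
- move=> x y [p [q [p0 q0 ->]]] [p' [q' [p0' q0' ->]]].
  exists (p * q' + p' * q), (q * q').
  rewrite mevalD !mevalM addr_gt0 ?mulr_gt0 // tofracD !tofracM.
  by rewrite addf_div ?nz.
- move=> x y [p [q [p0 q0 ->]]] [p' [q' [p0' q0' ->]]].
  exists (p * p'), (q * q').
  by rewrite !mevalM !mulr_gt0 // !tofracM mulf_div.
- by move=> x [p [q [p0 q0 ->]]]; exists q, p; rewrite invf_div.
Qed.

Lemma y_pos (n : nat) (hn : (0 < n)%N) (j : int) : frac_pos (y hn j).
Proof. by exists 'X_(yidx hn j), 1; rewrite mevalXU meval1 ltr01 tofrac1 divr1. Qed.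

(** * Comparison with the recursively defined [F] *)

Lemma Fshift_ideal_sum (n : nat) (hn : (0 < n)%N) (m : nat) (j : int) :
  Fshift hn m j = ideal_sum (y hn) j (m%:Z - 1).
Proof.
have cone := frac_pos_cone (2 * n).
have [pos0 pos1 posD posM posV] := cone.
have nz (x : {fraction {mpoly rat[2 * n]}}) : frac_pos x -> x != 0.
  by move=> h; apply/eqP => e; move: h; rewrite e; exact: pos0.
have u0 i : y hn i != 0 by exact/nz/y_pos.
have v0 i : 1 + y hn i != 0 by apply/nz/posD => //; exact: y_pos.
(* Positivity makes the divisor in the recursion nonzero, so that the recurrence for ideal sums can
   be solved for its highest term. *)
have ppos l i : frac_pos (Fshift hn l i) /\ frac_pos (Fshift hn l.+1 i).
  elim: l i => [//|l IH] i; split; first by case: (IH i).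
  have [_ h1] := IH (i - 3); have [_ h2] := IH (i + 3).
  have [_ h3] := IH (i - 1); have [_ h4] := IH (i + 1).
  have [h5 _] := IH i.
  apply: (posM); last exact: posV.
  apply: (posD); first exact: posM.
  apply: (posM) => //; apply: (posM) => //.
  by apply: (big_ind (@frac_pos _)) => // x _; exact: y_pos.
(* The recursion reaches back two levels, so two consecutive ones are carried through the
   induction. *)
suff H l i : Fshift hn l i = ideal_sum (y hn) i (l%:Z - 1) /\
    Fshift hn l.+1 i = ideal_sum (y hn) i l by case: (H m j).
elim: l i => [|l IH] i; first by rewrite ideal_sum_m1 ideal_sum_0.
split; first by rewrite (IH i).2; congr ideal_sum; lia.
have := ideal_sum_recurrence i l cone (y_pos hn).
have -> : l%:Z + 1 = l.+1 by lia.
rewrite -(IH i).1 -!(IH _).2 => /(canRL (mulfK (nz _ (ppos l i).1))) ->.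
by [].
Qed.

Theorem theorem6p6 (n : nat) (hn : (0 < n)%N) (j k : int) (hk : -1 <= k) :
  F hn j k = \sum_(I in J k) \prod_(x in I) ywt hn j (val x).
Proof.
have -> : F hn j k = ideal_sum (y hn) j k.
  (* The value [-1] is [Negz 0], where [F] is 1 by its default branch; smaller values contradict
     [hk]. *)
  case: k hk => [k|[|k]] hk //; last by rewrite ideal_sum_m1.
  by apply: etrans (Fshift_ideal_sum hn k.+1 j) _; congr ideal_sum; lia.
apply: eq_bigr => I _; apply: eq_bigr => x _.
by case: (val x) => [[r s] t].
Qed.
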